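(* Let $\Phi$ be a continuous semiflow on a Banach space $(X,\|\cdot\|_X)$ which is eventually compact and possesses a global attractor $\Gamma$, and suppose that $\Phi$ is uniformly eventually strongly monotone (UESM) with respect to nested invariant cones (NICs) $\{C^i\}_{i=0}^{N}$. Let $x,y\in\mathcal{R}(\Phi)$. Then there exists $j$ with $0<j\le N$ such that (a) $\omega(x)$ and $\omega(y)$ are strongly ordered with $\{C^i\}_{i=j}^{N}$; and (b) $\omega(x)$ and $\omega(y)$ are unordered with $\{C^i\}_{i=0}^{j-1}$.
   Context: **Semiflows.** A continuous semiflow on a Banach space $X$ is a continuous map $\Phi:[0,\infty)\times X\to X$, $\Phi_t(x)=\Phi(t,x)$, with $\Phi_0=\mathrm{id}$ and $\Phi_t\circ\Phi_s=\Phi_{t+s}$ for $t,s\ge0$. It is eventually compact if there is $\tau>0$ such that $\Phi_\tau(D)$ is relatively compact for every bounded $D\subset X$. A global attractor is a nonempty compact set $\Gamma\subset X$ with $\Phi_t(\Gamma)=\Gamma$ for all $t\ge0$ and $\lim_{t\to+\infty}\sup_{a\in\Phi_t(D)}\inf_{b\in\Gamma}\|a-b\|_X=0$ for every bounded $D\subset X$. The $\omega$-limit set is $\omega(x)=\bigcap_{t\ge0}\overline{\bigcup_{s\ge t}\{\Phi_s(x)\}}$. The point $x$ is recurrent if $x\in\omega(x)$; $\mathcal{R}(\Phi)$ is the set of recurrent points. **Cones.** A closed set $C\subset X$ is a $k$-cone if $lv\in C$ for all $v\in C$, $l\in\mathbb{R}$, and $\max\{\dim W: W\subset C \text{ a linear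 subspace}\}=k$. It is solid if $\operatorname{Int}C\ne\emptyset$. (Cones are not assumed convex.) **UESM.** $\Phi$ is UESM with respect to a solid cone $C$ if there is $T(C)>0$ such that $x-y\in C\setminus\{0\}$ implies $\Phi_t(x)-\Phi_t(y)\in\operatorname{Int}C$ for all $t\ge T(C)$. **NICs.** A sequence of closed sets $\{C^i\}_{i=0}^N$, $N\in\mathbb{N}\cup\{+\infty\}$, is called NICs for $\Phi$ if: (i) $\{0\}=C^0\subset\dots\subset C^{i-1}\subset C^i\subset\dots\subset C^N=X$; (ii) $C^i$ is a solid $k_i$-cone for all $0<i<N$, with $k_{i-1}<k_i$ for all $1<i<N$; (iii) for each $1\le i<N$ there is $t_*^i\ge0$ such that $x-y\in C^i$ implies $\Phi_t(x)-\Phi_t(y)\in C^i$ for every $t\ge t_*^i$. $\Phi$ is UESM with respect to the NICs if it is UESM with respect to $C^i$ for every $1\le i<N$. **Order between two sets.** Sets $U,V\subset X$ are strongly ordered with $\{C^i\}_{i\in\mathcal{I}}$ if $u-v\in\operatorname{Int}C^i$ for all $i\in\mathcal{I}$ and all $u\in U$, $v\in V$ with $u\ne v$; they are unordered with $\{C^i\}_{i\in\mathcal{I}}$ if $u-v\notin C^i$ for all $i\in\mathcal{I}$ and all $u\in U$, $v\in V$ with $u\ne v$. **Index convention.** If $N=+\infty$, the indices are $0,1,2,\dots$ together with $\infty$ (with $C^\infty=X$); $j=\infty$ is allowed, in which case $\{C^i\}_{i=0}^{j-1}$ means all $C^i$ with finite $i$. *)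

(* Defs.v *)
From HB Require Import structures.
From mathcomp Require Import all_boot all_order all_algebra.
From mathcomp Require Import all_classical all_reals all_analysis.

Set Implicit Arguments.
Unset Strict Implicit.
Unset Printing Implicit Defensive.

Import Order.TTheory GRing.Theory Num.Theory.
Import numFieldNormedType.Exports.

Local Open Scope classical_set_scope.
Local Open Scope ring_scope.

(* A semiflow is a map Phi : R -> X -> X of which only the values at times
   t >= 0 matter; the values at negative times are arbitrary. *)
Record continuous_semiflow (R : realType) (X : completeNormedModType R)
    (Phi : R -> X -> X) : Prop := ContinuousSemiflow {
  semiflow_continuous :
    {within [set p : R * X | 0 <= p.1], continuous (fun p => Phi p.1 p.2)} ;
  semiflow0 : forall x, Phi 0 x = x ;
  semiflowD : forall t s x, 0 <= t -> 0 <= s ->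
    Phi t (Phi s x) = Phi (t + s) x }.

Definition eventually_compact (R : realType) (X : completeNormedModType R)
    (Phi : R -> X -> X) : Prop :=
  exists2 tau : R, 0 < tau &
    forall D : set X, bounded_set D -> precompact (Phi tau @` D).

(* The restriction to D !=set0 is needed because ereal_sup set0 = -oo, whereas
   the supremum of an empty set of distances is conventionally 0. *)
Record global_attractor (R : realType) (X : completeNormedModType R)
    (Phi : R -> X -> X) (Gamma : set X) : Prop := GlobalAttractor {
  attractor_nonempty : Gamma !=set0 ;
  attractor_compact : compact Gamma ;
  attractor_invariant : forall t, 0 <= t -> Phi t @` Gamma = Gamma ;
  attractor_attracts : forall D : set X, bounded_set D -> D !=set0 ->
    ereal_sup [set ereal_inf [set (`|a - b|)%:E | b in Gamma]
              | a in Phi t @` D] @[t --> +oo] --> 0%E }.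

Definition omega_limit (R : realType) (X : completeNormedModType R)
    (Phi : R -> X -> X) (x : X) : set X :=
  \bigcap_(t in [set t : R | 0 <= t])
    closure (\bigcup_(s in [set s : R | t <= s]) [set Phi s x]).

Definition recurrent (R : realType) (X : completeNormedModType R)
    (Phi : R -> X -> X) : set X :=
  [set x | omega_limit Phi x x].

Definition is_subspace (R : realType) (X : completeNormedModType R)
    (W : set X) : Prop :=
  W 0 /\ forall (a : R) (u v : X), W u -> W v -> W (a *: u + v).

Definition is_basis (R : realType) (X : completeNormedModType R)
    (W : set X) (n : nat) (b : 'I_n -> X) : Prop :=
  (forall a : 'I_n -> R, \sum_i a i *: b i = 0 -> forall i, a i = 0) /\
  W = [set \sum_i a i *: b i | a in [set: 'I_n -> R]].

Definition has_dim (R : realType) (X : completeNormedModType R)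
    (W : set X) (n : nat) : Prop :=
  is_subspace W /\ exists b : 'I_n -> X, is_basis W b.

Record is_kcone (R : realType) (X : completeNormedModType R)
    (k : nat) (C : set X) : Prop := IsKCone {
  kcone_closed : closed C ;
  kcone_scale : forall (l : R) v, C v -> C (l *: v) ;
  kcone_dim_attained : exists2 W : set X, W `<=` C & has_dim W k ;
  kcone_dim_max : forall W : set X, is_subspace W -> W `<=` C ->
    exists2 m, (m <= k)%N & has_dim W m }.

Definition solid (R : realType) (X : completeNormedModType R)
    (C : set X) : Prop := interior C !=set0.

Definition UESM (R : realType) (X : completeNormedModType R)
    (Phi : R -> X -> X) (C : set X) : Prop :=
  exists2 T : R, 0 < T &
    forall x y, (C `\` [set 0]) (x - y) ->
    forall t, T <= t -> interior C (Phi t x - Phi t y).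

Inductive enat : Type := Fin of nat | Infty.
Coercion Fin : nat >-> enat.

Definition ele (i j : enat) : bool :=
  match i, j with
  | _, Infty => true
  | Infty, Fin _ => false
  | Fin m, Fin n => (m <= n)%N
  end.

Definition elt (i j : enat) : bool := ~~ ele j i.

(* The sequence {C^i}_{0 <= i <= N} is given by C : enat -> set X, of which
   only the values at indices i <= N matter.  For N = Infty these indices are
   0, 1, 2, ... and Infty.  The indices i with i < N are always finite, hence
   the quantifications over nat.  As N = 0 would force {0} = X and leave no
   index j with 0 < j <= N, N is taken to be at least 1. *)
Record NICs (R : realType) (X : completeNormedModType R)
    (Phi : R -> X -> X) (N : enat) (C : enat -> set X) : Prop := IsNICs {
  nics_N_gt0 : elt 0%N N ;
  nics_closed : forall i : enat, ele i N -> closed (C i) ;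
  nics_first : C 0%N = [set 0] ;
  nics_nested : forall i : nat, ele i.+1 N -> C i `<=` C i.+1 ;
  nics_last : C N = [set: X] ;
  nics_cones : exists k : nat -> nat,
    (forall i : nat, (0 < i)%N -> elt i N -> solid (C i) /\ is_kcone (k i) (C i))
    /\ (forall i : nat, (1 < i)%N -> elt i N -> (k i.-1 < k i)%N) ;
  nics_invariant : forall i : nat, (1 <= i)%N -> elt i N ->
    exists2 t_star : R, 0 <= t_star &
      forall x y, C i (x - y) ->
      forall t, t_star <= t -> C i (Phi t x - Phi t y) }.

Definition UESM_NICs (R : realType) (X : completeNormedModType R)
    (Phi : R -> X -> X) (N : enat) (C : enat -> set X) : Prop :=
  forall i : nat, (1 <= i)%N -> elt i N -> UESM Phi (C i).

Definition strongly_ordered (R : realType) (X : completeNormedModType R)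
    (I : set enat) (C : enat -> set X) (U V : set X) : Prop :=
  forall i, I i -> forall u v, U u -> V v -> u <> v -> interior (C i) (u - v).

Definition unordered (R : realType) (X : completeNormedModType R)
    (I : set enat) (C : enat -> set X) (U V : set X) : Prop :=
  forall i, I i -> forall u v, U u -> V v -> u <> v -> ~ C i (u - v).

(* Main.v *)
Require Import Defs.
From HB Require Import structures.
From mathcomp Require Import all_boot all_order all_algebra.
From mathcomp Require Import all_classical all_reals all_analysis.
From mathcomp Require Import lra.

(* For a single cone [C], let [x], [y] be recurrent. If [x - y] is in [C] for
   one pair of points of the orbits, then so it is for all pairs: the set of
   pairs [(a, b)] of times with [Phi a x - Phi b y] in [C] is closed, and it is
   open since membership in [C] improves to membership in its interior.

   The improvement needs a kind of joint recurrence of [(x, y)], which two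
   recurrent points need not have. If [x] is not in [omega y], a
   pseudo-orbit of pairs replaces it: [x] may be reset after each of its returns
   without leaving [C], because it keeps a positive distance from [omega y].
   If [x] is in [omega y], then [omega x] is contained in [omega y] and it
   suffices to compare the orbit of [y] with itself; the pairs [(y, Phi c y)]
   are jointly recurrent, and connectedness is applied to the times [c] between
   two consecutive returns of [y] to itself.

   Points of an omega-limit set of a recurrent point have preimages in it under
   [Phi T], so the closed relation obtained as a limit is again strong. *)

Set Implicit Arguments.
Unset Strict Implicit.
Unset Printing Implicit Defensive.

Import Order.TTheory GRing.Theory Num.Theory.
Import numFieldNormedType.Exports.

Local Open Scope classical_set_scope.
Local Open Scope ring_scope.

(** * Omega-limit sets of a semiflow *)

Section OmegaLimits.
Context {R : realType} {X : completeNormedModType R}.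
Context {Phi : R -> X -> X} (flow : continuous_semiflow Phi).
Implicit Types (x y u v : X) (t s : R).

Lemma omega_limitP x u : omega_limit Phi x u <->
  forall t (U : set X), nbhs u U -> exists s, [/\ 0 <= s, t <= s & U (Phi s x)].
Proof.
split=> [xu t U uU|xu t /= t0 U uU].
  have t0 : 0 <= Num.max 0 t by rewrite le_max lexx.
  have [_ [[s /= + ->] Us]] := xu (Num.max 0 t) t0 _ uU.
  by rewrite ge_max => /andP[]; exists s.
by have [s [s0 ts Us]] := xu t U uU; exists (Phi s x); split=> //; exists s.
Qed.

Lemma semiflowC t s x : 0 <= t -> 0 <= s -> Phi t (Phi s x) = Phi s (Phi t x).
Proof. by move=> t0 s0; rewrite !(semiflowD flow)// addrC. Qed.

(** Clamping the time at 0 turns continuity on nonnegative times into continuity on the whole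
    product, so that orbits become continuous functions on all of [R]. *)
Lemma semiflow_max_continuous :
  continuous (fun p : R * X => Phi (Num.max 0 p.1) p.2).
Proof.
move=> p; pose g (q : R * X) := (Num.max 0 q.1, q.2).
have gp : {for p, continuous g}.
  apply: (@cvg_pair _ _ _ _ (nbhs (Num.max 0 p.1)) (nbhs p.2)); last exact: cvg_snd.
  apply: (@continuous_max _ _ (fun=> 0) fst p); first exact: cvg_cst.
  exact: cvg_fst.
have /subspace_continuousP/(_ (g p)) Phig := semiflow_continuous flow.
apply: (@cvg_comp _ _ _ g (fun q => Phi q.1 q.2) _ (within [set q | 0 <= q.1] (nbhs (g p)))).
  move=> V gpV; rewrite /= in gpV *.
  apply: (@filterS _ _ _ (g @^-1` [set r | 0 <= r.1 -> V r])) (gp _ gpV) => q.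
  by move=> /= Vq; apply: Vq; rewrite le_max lexx.
by apply: Phig; rewrite /g /= le_max lexx.
Qed.

Lemma semiflow_continuousr t : 0 <= t -> continuous (Phi t).
Proof.
move=> t0 x.
have -> : Phi t = (fun p : R * X => Phi (Num.max 0 p.1) p.2) \o (fun u => (t, u)).
  by apply/funext => u /=; rewrite max_r.
apply: continuous_comp; last exact: semiflow_max_continuous.
by apply: (@cvg_pair _ _ _ _ (nbhs t) (nbhs x)); [exact: cvg_cst|exact: cvg_id].
Qed.

Lemma orbit_continuous x : continuous (fun t => Phi (Num.max 0 t) x).
Proof.
move=> t.
rewrite [X in continuous_at _ X](_ : _ =
  (fun p : R * X => Phi (Num.max 0 p.1) p.2) \o (fun s => (s, x))) //.
apply: continuous_comp; last exact: semiflow_max_continuous.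
by apply: (@cvg_pair _ _ _ _ (nbhs t) (nbhs x)); [exact: cvg_id|exact: cvg_cst].
Qed.

Lemma omega_limit_invariant x u t :
  0 <= t -> omega_limit Phi x u -> omega_limit Phi x (Phi t u).
Proof.
move=> t0 /omega_limitP xu; apply/omega_limitP => s U.
move=> /(semiflow_continuousr t0)/(xu s)[r [r0 sr Ur]].
by exists (t + r); split; rewrite -?semiflowD//; lra.
Qed.

Lemma omega_limit_shift x a : 0 <= a -> omega_limit Phi (Phi a x) = omega_limit Phi x.
Proof.
move=> a0; apply/seteqP; split=> u /omega_limitP xu; apply/omega_limitP => t U uU.
  have [s [s0 ts Us]] := xu t U uU.
  by exists (s + a); split; rewrite -?semiflowD//; lra.
have [s [s0 + Us]] := xu (Num.max 0 t + a) U uU.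
rewrite -lerBrDr ge_max => /andP[sa ts].
by exists (s - a); split; rewrite ?semiflowD ?subrK.
Qed.

End OmegaLimits.

(** * Compactness of omega-limit sets and preimages in them *)

Section AttractorCompactness.
Context {R : realType} {X : completeNormedModType R}.
Context {Phi : R -> X -> X} (flow : continuous_semiflow Phi).
Context {Gamma : set X} (attractor : global_attractor Phi Gamma).
Implicit Types (x y u v : X) (t s : R).

Lemma omega_limit_closed x : closed (omega_limit Phi x).
Proof. by apply: closed_bigI => t _; exact: closed_closure. Qed.

Lemma omega_limit_sub_closed x t (F : set X) : closed F ->
  (forall s, 0 <= s -> t <= s -> F (Phi s x)) -> omega_limit Phi x `<=` F.
Proof.
move=> Fcl tF u /omega_limitP xu; apply: Fcl => U uU.
by have [s [s0 ts Us]] := xu t U uU; exists (Phi s x); split=> //; exact: tF.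
Qed.

(** If a ball around [u] missed [Gamma], the orbit of [x] would visit the ball of half the radius at
    late times, when it is already within that half radius of [Gamma]. *)
Lemma omega_limit_sub_attractor x : omega_limit Phi x `<=` Gamma.
Proof.
move=> u /omega_limitP xu; apply: contrapT => nGu.
have Gcl : closed Gamma.
  by apply: compact_closed (attractor_compact attractor); exact: norm_hausdorff.
have /nbhs_ballP[e /= e0 ue] : nbhs u (~` Gamma).
  by apply: open_nbhs_nbhs; split=> //; exact: closed_openC.
have e2 : 0 < e / 2 by rewrite divr_gt0.
have x_bounded : bounded_set [set x] 
    by exists `|x|; split=> [|M xM _ ->]; [exact: num_real|exact: ltW].
have := attractor_attracts attractor x_bounded (ex_intro _ x erefl).
move=> /(_ [set r | r < (e / 2)%:E]%E) -[|M [_ Mx]].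
  by apply: open_nbhs_nbhs; split; [exact: open_ereal_lt_ereal|rewrite /= lte_fin].
have [s [s0 Ms us]] := xu (M + 1) _ (nbhsx_ballx u _ e2).
have /Mx /= : M < s by lra.
apply/negP; rewrite -leNgt; apply: le_trans (ereal_sup_ubound _); last first.
  by exists (Phi s x) => //; exists x.
apply: le_ereal_inf_tmp => _ [b Gb <-]; rewrite lee_fin leNgt; apply/negP => sb.
apply: (ue b) => //; rewrite (splitr e); apply: ball_triangle us _.
by rewrite -ball_normE /=.
Qed.

Lemma omega_limit_compact x : compact (omega_limit Phi x).
Proof.
apply: (subclosed_compact _ (attractor_compact attractor)).
  exact: omega_limit_closed.
exact: omega_limit_sub_attractor.
Qed.

Lemma recurrent_orbit x t :
  recurrent Phi x -> 0 <= t -> omega_limit Phi x (Phi t x).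
Proof. by move=> xx t0; exact: omega_limit_invariant. Qed.

Lemma recurrent_shift x t :
  recurrent Phi x -> 0 <= t -> recurrent Phi (Phi t x).
Proof. by move=> xx t0; rewrite /recurrent /= omega_limit_shift//; exact: recurrent_orbit. Qed.

(** The image of [K] is closed and contains the orbit from time [t + t] on. Leaving [K] general
    allows a closed relation to be imposed on the preimages. *)
Lemma omega_limit_sub_image x t (K : set X) : 0 <= t -> compact K ->
  (forall s, t <= s -> K (Phi s x)) -> omega_limit Phi x `<=` Phi t @` K.
Proof.
move=> t0 Kcp tK; apply: (@omega_limit_sub_closed x (t + t)).
  apply: compact_closed; first exact: norm_hausdorff.
  apply: continuous_compact Kcp; apply: continuous_subspaceT.
  exact: (semiflow_continuousr flow).
move=> s s0 tts; exists (Phi (s - t) x); first by apply: tK; lra.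
by rewrite (semiflowD flow)//; [rewrite subrKC|lra].
Qed.

Lemma recurrent_preimage x t u : recurrent Phi x -> 0 <= t ->
  omega_limit Phi x u -> exists2 w, omega_limit Phi x w & Phi t w = u.
Proof.
move=> xx t0; apply: omega_limit_sub_image => //; first exact: omega_limit_compact.
by move=> s ts; apply: recurrent_orbit => //; exact: le_trans ts.
Qed.

End AttractorCompactness.

(** * Stability of open conditions, and connectedness *)

Lemma nbhs_sub_ball {R : realType} {X : normedModType R} (C : set X) (a b : X) :
  nbhs (a - b) C -> exists2 e : R, 0 < e &
    forall a' b', `|a - a'| < e -> `|b - b'| < e -> nbhs (a' - b') C.
Proof.
move=> /nbhs_interior/nbhs_ballP[r /= r0 rC]; exists (r / 2); first by rewrite divr_gt0.
move=> a' b' aa bb; apply: rC; rewrite -ball_normE /ball_ /=.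
rewrite (_ : a - b - (a' - b') = (a - a') - (b - b')); last first.
  by rewrite !opprD !opprK addrACA.
by rewrite (le_lt_trans (ler_normB _ _))// (splitr r) ltrD.
Qed.

(** The times of the segment at which [g] lies in [C] form a nonempty set that is closed and open in
    the segment. *)
Lemma connected_inside {R : realType} {X : topologicalType} (C : set X)
    (g : R -> X) (a b : R) : closed C -> continuous g ->
  (forall t, `[a, b]%classic t -> C (g t) -> nbhs (g t) C) ->
  (exists2 t, `[a, b]%classic t & C (g t)) ->
  forall t, `[a, b]%classic t -> C (g t).
Proof.
move=> Ccl gc gC [t0 abt0 Ct0] t abt.
suff E : `[a, b]%classic `&` g @^-1` C = `[a, b]%classic.
  by move: abt; rewrite -E => -[].
apply: (@segment_connected R a b).
- by exists t0.
- exists (g @^-1` C°).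
    by apply: open_comp => [? _|]; [exact: gc|exact: open_interior].
  apply/seteqP; split=> s [abs gs]; split=> //; first exact: gC.
  exact: interior_subset gs.
- by exists (g @^-1` C) => //; apply: preimage_closed => // ? _; exact: gc.
Qed.

(** * The order between two orbits for one strongly monotone cone *)

Section StronglyMonotoneCone.
Context {R : realType} {X : completeNormedModType R}.
Context {Phi : R -> X -> X} (flow : continuous_semiflow Phi).
Context {Gamma : set X} (attractor : global_attractor Phi Gamma).
Context {C : set X} (C_closed : closed C) (C0 : C 0).
Context (CN : forall u, C u -> C (- u)).
Context {T : R} (T_gt0 : 0 < T).
Context (mono : forall x y, (C `\` [set 0]) (x - y) ->
  forall t, T <= t -> nbhs (Phi t x - Phi t y) C).
Implicit Types (x y z u v w : X) (t s : R).

Lemma cone_sym u v : C (u - v) -> C (v - u).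
Proof. by rewrite -[v - u]opprB; exact: CN. Qed.

Lemma strong_mono x y t : x <> y -> C (x - y) -> T <= t ->
  nbhs (Phi t x - Phi t y) C.
Proof. by move=> xy Cxy; apply: mono; split=> // /subr0_eq. Qed.

Lemma weak_mono x y t : C (x - y) -> T <= t -> C (Phi t x - Phi t y).
Proof.
move=> Cxy Tt; have [->|/eqP xy] := eqVneq x y; first by rewrite subrr.
by apply: nbhs_singleton; exact: strong_mono.
Qed.

Lemma closed_subl v : closed [set u | C (u - v)].
Proof.
apply: (@preimage_closed _ _ (fun u => u - v)) => // u _.
by apply: cvgB; [exact: cvg_id|exact: cvg_cst].
Qed.

Lemma closed_subr u : closed [set v | C (u - v)].
Proof.
apply: (@preimage_closed _ _ (fun v => u - v)) => // v _.
by apply: cvgB; [exact: cvg_cst|exact: cvg_id].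
Qed.

(** The closed relation passes to the limit in one variable at a time. It is applied to preimages of
    [u] and [v] under [Phi T], so that strong monotonicity puts [u - v] in the interior. *)
Lemma strongly_ordered_limits x y s : recurrent Phi x -> recurrent Phi y ->
  (forall a b, 0 <= a -> 0 <= b -> s <= a -> s <= b -> C (Phi a x - Phi b y)) ->
  forall u v, omega_limit Phi x u -> omega_limit Phi y v -> u <> v ->
  nbhs (u - v) C.
Proof.
move=> xx yy Cxy u v xu yv.
have [u' xu' <-] := recurrent_preimage flow attractor xx (ltW T_gt0) xu.
have [v' yv' <-] := recurrent_preimage flow attractor yy (ltW T_gt0) yv.
move=> uv; apply: strong_mono => //; first by move=> uv'; rewrite uv' in uv.
suff : omega_limit Phi x `<=` [set w | C (w - v')] by apply.
apply: (@omega_limit_sub_closed _ _ _ _ s) => [|a a0 sa /=]; first exact: closed_subl.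
suff : omega_limit Phi y `<=` [set w | C (Phi a x - w)] by apply.
apply: (@omega_limit_sub_closed _ _ _ _ s) => [|b b0 sb /=]; first exact: closed_subr.
exact: Cxy.
Qed.

(** [Phi T u] and [Phi T v] are strongly ordered limit points, and each orbit comes close to its own
    one, at times [a] and [b] that are unrelated. *)
Lemma ordered_orbit_points x y u v : omega_limit Phi x u -> omega_limit Phi y v ->
  u <> v -> C (u - v) -> exists a b, [/\ 0 <= a, 0 <= b & nbhs (Phi a x - Phi b y) C].
Proof.
move=> xu yv uv Cuv; have /nbhs_sub_ball[e e0 eC] := strong_mono uv Cuv (lexx T).
have T0 := ltW T_gt0.
have /omega_limitP/(_ 0 _ (nbhsx_ballx _ _ e0))[a [a0 _ ua]] := omega_limit_invariant flow T0 xu.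
have /omega_limitP/(_ 0 _ (nbhsx_ballx _ _ e0))[b [b0 _ vb]] := omega_limit_invariant flow T0 yv.
by exists a, b; split=> //; apply: eC; rewrite -ball_normE in ua vb.
Qed.

(** For a single ordered pair, either [Phi T u = x], and then [u <> v] and the order of the images
    is open, or [Phi T u] keeps away from [x], and the premise fails for small [e]. Compactness of
    the set of ordered pairs makes [e] uniform. *)
Lemma return_margin x (A B : set X) : compact A -> compact B ->
  (forall v, B v -> Phi T v <> x) ->
  exists2 e : R, 0 < e & forall u v w, A u -> B v -> C (u - v) ->
    `|x - Phi T u| < e -> `|Phi T v - w| < e -> nbhs (x - w) C.
Proof.
move=> Acp Bcp Bx.
have PhiT := semiflow_continuousr flow (ltW T_gt0).
have : compact ((A `*` B) `&` [set p | C (p.1 - p.2)]).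
  apply: compact_closedI; first exact: compact_setX.
  apply: (@preimage_closed _ _ (fun p : X * X => p.1 - p.2)) => // p _.
  by apply: cvgB; [exact: cvg_fst|exact: cvg_snd].
move=> /compact_near_coveringP/(_ _ (0 : R)^'+ (fun e p => forall w,
  `|x - Phi T p.1| < e -> `|Phi T p.2 - w| < e -> nbhs (x - w) C)).
case=> [|e /= e0 Ce].
- move=> [u v] [[/= Au Bv] Cuv].
  have [Tux|/eqP Tux] := eqVneq (Phi T u) x.
    have uv : u <> v by move=> uv; apply: (Bx v Bv); rewrite -uv.
    have := strong_mono uv Cuv (lexx T); rewrite Tux => /nbhs_sub_ball[d d0 dC].
    have d2 : 0 < d / 2 by rewrite divr_gt0.
    exists ([set p | `|Phi T v - Phi T p.2| < d / 2], [set e | e < d / 2]).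
      split; last exact: nbhs_right_lt.
      have : {for (u, v), continuous (Phi T \o snd)}.
        by apply: continuous_comp; [exact: cvg_snd|exact: PhiT].
      by move/cvgrPdist_lt; apply.
    move=> [p e] [/= vp ed] w _ pw; apply: dC; rewrite ?subrr ?normr0//.
    rewrite (splitr d) (le_lt_trans (ler_distD (Phi T p.2) _ _))// ltrD//.
    exact: lt_trans ed.
  have d0 : 0 < `|x - Phi T u| / 2.
    by rewrite divr_gt0// normr_gt0 subr_eq0 eq_sym; apply/eqP.
  exists ([set p | `|Phi T u - Phi T p.1| < `|x - Phi T u| / 2],
          [set e | e < `|x - Phi T u| / 2]).
    split; last exact: nbhs_right_lt.
    have : {for (u, v), continuous (Phi T \o fst)}.
      by apply: continuous_comp; [exact: cvg_fst|exact: PhiT].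
    by move/cvgrPdist_lt; apply.
  move=> [p e] [/= up ed] w xp _; exfalso.
  have := ler_distD (Phi T p.1) x (Phi T u); rewrite (distrC (Phi T p.1)); lra.
exists (e / 2); first by rewrite divr_gt0.
move=> u v w Au Bv Cuv; apply: (Ce (e / 2) _ _ (u, v)) => //=.
- by rewrite sub0r normrN gtr0_norm ?divr_gt0//; lra.
- by rewrite divr_gt0.
Qed.

Lemma recurrent_return x e t : recurrent Phi x -> 0 < e ->
  exists s, [/\ 0 <= s, t <= s & `|x - Phi s x| < e].
Proof.
move=> /omega_limitP xx e0.
have [s [s0 ts xs]] := xx t _ (nbhsx_ballx x _ e0).
by exists s; split=> //; rewrite -ball_normE in xs.
Qed.

(* A pseudo-orbit argument: [x] nearly returns to itself at every time in
   [[tau, tau + d]], and a long return time of [y] can be cut into [n] steps of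
   a common length [g] in that interval. After each step the first point is
   reset to [x]; since [x] keeps away from [omega y], these resets preserve the
   order. *)
Lemma ordered_interior x y : recurrent Phi x -> recurrent Phi y ->
  ~ omega_limit Phi y x -> C (x - y) -> nbhs (x - y) C.
Proof.
move=> xx yy nyx Cxy.
have T0 := ltW T_gt0.
have wcp z : compact (omega_limit Phi z) by exact: omega_limit_compact attractor z.
have [|e e0 eC] := return_margin (x := x) (wcp x) (wcp y).
  by move=> v yv xv; apply: nyx; rewrite -xv; exact: omega_limit_invariant.
(* The time [t] is split into [t - T], long enough to keep the order, and a final [T] to which the
   margin [e] applies. *)
have reset t v w : T + T <= t -> omega_limit Phi y v -> C (x - v) ->
    `|x - Phi t x| < e -> `|Phi t v - w| < e -> nbhs (x - w) C.
  move=> TTt yv Cxv xt vw.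
  have tT : T <= t - T by lra.
  have Phit u : Phi T (Phi (t - T) u) = Phi t u.
    by rewrite (semiflowD flow)//; [rewrite subrKC|lra].
  apply: (eC (Phi (t - T) x) (Phi (t - T) v)); rewrite ?Phit//.
  - by apply: recurrent_orbit => //; lra.
  - by apply: omega_limit_invariant => //; lra.
  - exact: weak_mono.
have [tau [_ Ttau xtau]] := recurrent_return (T + T) xx e0.
have tau0 : 0 < tau by apply: lt_le_trans Ttau; rewrite addr_gt0.
have [d d0 xtaud] : exists2 d, 0 < d & forall s, tau <= s <= tau + d ->
    `|x - Phi s x| < e.
  have /cvgrPdist_lt := @orbit_continuous _ _ _ flow x tau.
  rewrite max_r ?ltW// => /(_ (e - `|x - Phi tau x|)).
  rewrite subr_gt0 => /(_ xtau)[d /= d0 dtau].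
  exists (d / 2); first by rewrite divr_gt0.
  move=> s /andP[taus sd]; rewrite (le_lt_trans (ler_distD (Phi tau x) _ _))//.
  rewrite addrC -ltrBrDr; have /= := dtau s; rewrite max_r; last by lra.
  by apply; rewrite distrC ger0_norm; lra.
(* This bound forces [n > tau / d], so that [sigma / n], which is below [tau + tau / n], does not
   exceed [tau + d]. *)
have [sigma [sigma0 sigma_ge ysigma]] :=
  recurrent_return (tau * (tau / d + 1)) yy e0.
pose n := Num.truncn (sigma / tau).
have /truncn_itv/andP[] : 0 <= sigma / tau by rewrite divr_ge0// ltW.
rewrite -/n ler_pdivlMr// ltr_pdivrMr// -[n.+1]addn1 natrD => ntau sigma_lt.
have ngt : tau / d < n%:R.
  rewrite -(ltrD2r 1) -(ltr_pM2l tau0); apply: le_lt_trans sigma_ge _.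
  by rewrite mulrC.
have n0 : 0 < n%:R :> R by apply: lt_trans ngt; rewrite divr_gt0.
rewrite ltr_pdivrMr// in ngt.
pose g := sigma / n%:R.
have /andP[gtau gtaud] : tau <= g <= tau + d.
  by rewrite ler_pdivlMr// ler_pdivrMr// mulrC ntau /= mulrDl; lra.
have TTg : T + T <= g := le_trans Ttau gtau.
have g0 : 0 <= g by exact: le_trans (ltW tau0) gtau.
have Phi_step j : Phi g (Phi (j%:R * g) y) = Phi (j.+1%:R * g) y.
  by rewrite (semiflowD flow) ?mulr_ge0// -[j.+1]add1n natrD mulrDl mul1r.
have orbit_y j : omega_limit Phi y (Phi (j%:R * g) y).
  by apply: recurrent_orbit => //; rewrite mulr_ge0.
have chain j : C (x - Phi (j%:R * g) y).
  elim: j => [|j IH]; first by rewrite mul0r (semiflow0 flow).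
  apply: nbhs_singleton; apply: (reset g (Phi (j%:R * g) y)) => //.
    by apply: xtaud; rewrite gtau.
  by rewrite Phi_step subrr normr0.
have n_gt0 : (0 < n)%N by rewrite -(ltr0n R).
(* The last step ends at [Phi sigma y], which is [e]-close to [y], so the second point is reset to
   [y] as well. *)
apply: (reset g (Phi (n.-1%:R * g) y)) => //.
  by apply: xtaud; rewrite gtau.
by rewrite Phi_step prednK// /g mulrC divfK ?gt_eqF// distrC.
Qed.

Lemma ordered_orbit (g : R -> X) t0 : continuous g ->
  (forall t, 0 <= t -> C (g t) -> nbhs (g t) C) -> 0 <= t0 -> C (g t0) ->
  forall t, 0 <= t -> C (g t).
Proof.
move=> gc gC t00 Ct0 t tge0.
apply: (@connected_inside _ _ C g 0 (Num.max t t0)) => //.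
- by move=> s /=; rewrite in_itv /= => /andP[s0 _]; exact: gC.
- by exists t0 => //=; rewrite in_itv /= t00 le_max lexx orbT.
- by rewrite /= in_itv /= tge0 le_max lexx.
Qed.

(** One time varies while the other is fixed: the order at [(a, b)] spreads to all [(s, b)], then to
    all [(s, t)]. Openness comes from [ordered_interior] at the shifted points. *)
Lemma strongly_ordered_separated x y u v : recurrent Phi x -> recurrent Phi y ->
  ~ omega_limit Phi y x -> omega_limit Phi x u -> omega_limit Phi y v ->
  u <> v -> C (u - v) ->
  forall u' v', omega_limit Phi x u' -> omega_limit Phi y v' -> u' <> v' ->
  nbhs (u' - v') C.
Proof.
move=> xx yy nyx xu yv uv Cuv.
have [a [b [a0 b0 /nbhs_singleton Cab]]] := ordered_orbit_points xu yv uv Cuv.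
have interior_points s t : 0 <= s -> 0 <= t -> C (Phi s x - Phi t y) ->
    nbhs (Phi s x - Phi t y) C.
  move=> s0 t0.
  apply: ordered_interior.
  - exact: recurrent_shift.
  - exact: recurrent_shift.
  (* If [Phi s x] were in the omega-limit set of [y], so would be the later orbit of [x], and by
     recurrence [x] itself. *)
  rewrite (omega_limit_shift flow)// => yx; apply: nyx.
  suff : omega_limit Phi x `<=` omega_limit Phi y by apply.
  apply: (@omega_limit_sub_closed _ _ _ x s); first exact: omega_limit_closed.
  move=> r r0 sr; rewrite -[r](subrK s) -(semiflowD flow) ?subr_ge0//.
  by apply: omega_limit_invariant; rewrite ?subr_ge0.
have Cb s : 0 <= s -> C (Phi s x - Phi b y).
  move=> s0; have := @ordered_orbit (fun t => Phi (Num.max 0 t) x - Phi b y) a.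
  rewrite max_r// => /(_ _ _ a0 Cab s s0); rewrite max_r//; apply.
    by move=> t; apply: cvgB; [exact: (orbit_continuous flow)|exact: cvg_cst].
  by move=> t t0; rewrite max_r//; exact: interior_points.
apply: (@strongly_ordered_limits x y 0) => //.
move=> s t s0 t0 _ _.
have := @ordered_orbit (fun t => Phi s x - Phi (Num.max 0 t) y) b.
rewrite max_r// => /(_ _ _ b0 (Cb s s0) t t0); rewrite max_r//; apply.
  by move=> r; apply: cvgB; [exact: cvg_cst|exact: (orbit_continuous flow)].
by move=> r r0; rewrite max_r//; exact: interior_points.
Qed.

(** Since [Phi c] commutes with the flow, the relation between [Phi c u] and [u] persists along the
    orbit of [z] from time [T] on. Hence [z] has a preimage under [Phi T] that satisfies it too. *)
Lemma self_ordered_interior z c : recurrent Phi z -> 0 <= c -> Phi c z <> z ->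
  C (Phi c z - z) -> nbhs (Phi c z - z) C.
Proof.
move=> zz c0 cz Cz; have T0 := ltW T_gt0.
pose K := omega_limit Phi z `&` [set u | C (Phi c u - u)].
have Kcp : compact K.
  apply: compact_closedI; first exact: (omega_limit_compact attractor).
  apply: (@preimage_closed _ _ (fun u => Phi c u - u)) => // u _.
  by apply: cvgB; [exact: (semiflow_continuousr flow)|exact: cvg_id].
have TK s : T <= s -> K (Phi s z).
  move=> Ts; have s0 : 0 <= s by exact: le_trans Ts.
  split; first exact: recurrent_orbit.
  rewrite /= (semiflowC flow)//.
  exact: weak_mono.
have [w [_ Cw] wz] := omega_limit_sub_image flow T0 Kcp TK zz.
have PhiT : Phi c z = Phi T (Phi c w).
  by rewrite -wz (semiflowC flow).
rewrite PhiT -[X in _ - X]wz; apply: strong_mono => // cw.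
by apply: cz; rewrite PhiT cw.
Qed.

(* [c - c'] is the last time up to [c] at which [z] returns to itself. *)
Lemma return_free_time z c : 0 <= c -> Phi c z <> z ->
  exists c', [/\ 0 < c', Phi c' z = Phi c z &
    forall s, 0 < s -> s <= c' -> Phi s z <> z].
Proof.
move=> c0 cz.
pose S := [set s | 0 <= s <= c /\ Phi s z = z].
have S0 : S 0 by split; [rewrite lexx|rewrite (semiflow0 flow)].
have Ssup : has_sup S by split; [exists 0|exists c => s [/andP[]]].
have Scl : closed S.
  have -> : S = `[0, c]%classic `&` (fun s => Phi (Num.max 0 s) z) @^-1` [set z].
    apply/seteqP; split=> s /=; rewrite in_itv /=.
      by move=> [/andP[s0 sc] sz]; split; rewrite ?s0 ?max_r.
    by move=> [/andP[s0 sc]]; rewrite max_r// => sz; split; rewrite ?s0.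
  apply: closedI; first exact: itv_closed.
  apply: preimage_closed => [s _|]; first exact: (orbit_continuous flow).
  by apply: compact_closed; [exact: norm_hausdorff|exact: compact_set1].
have [/andP[p0 pc] pz] : S (sup S).
  by apply: Scl; case: Ssup => S1 S2; exact: closure_sup.
set p := sup S in p0 pc pz.
exists (c - p); split.
- rewrite subr_gt0 lt_neqAle pc andbT; apply/eqP => pE.
  by apply: cz; rewrite -pE.
- by rewrite -[in LHS]pz (semiflowD flow) ?subr_ge0// subrK.
(* A return after time [s] would make [s + p] a return time in [S] beyond its supremum. *)
- move=> s s0 sc sz; have : s + p <= p.
    apply: ub_le_sup; first by case: Ssup.
    split; first by rewrite addr_ge0 ?(ltW s0)//= -lerBrDr.
    by rewrite -(semiflowD flow) ?(ltW s0)// pz.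
  by rewrite gerDr leNgt s0.
Qed.

(** At a return to [z] the difference is 0 and openness may fail. So [c0] and [c] are replaced by
    times [d0] and [d] that reach the same points before any return; no return occurs between them
    either. *)
Lemma self_ordered z c0 : recurrent Phi z -> 0 <= c0 -> Phi c0 z <> z ->
  C (Phi c0 z - z) -> forall c, 0 <= c -> C (Phi c z - z).
Proof.
move=> zz c00 c0z Cc0 c cge0.
have [->|/eqP cz] := eqVneq (Phi c z) z; first by rewrite subrr.
have [d0 [d0_gt0 d0E d0free]] := return_free_time c00 c0z.
have [d [d_gt0 dE dfree]] := return_free_time cge0 cz.
have <- : Phi (Num.max 0 d) z = Phi c z by rewrite max_r ?dE ?(ltW d_gt0).
apply: (@connected_inside _ _ C (fun t => Phi (Num.max 0 t) z - z)
  (Num.min d d0) (Num.max d d0)) => //=.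
- by move=> t; apply: cvgB; [exact: (orbit_continuous flow)|exact: cvg_cst].
- move=> t; rewrite in_itv /= ge_min le_max => /andP[dt td] Ct.
  have t0 : 0 < t by case/orP: dt; exact: lt_le_trans.
  rewrite max_r ?(ltW t0)// in Ct *.
  apply: self_ordered_interior => //; first exact: ltW.
  by case/orP: td; [exact: dfree|exact: d0free].
- exists d0; last by rewrite max_r ?d0E ?(ltW d0_gt0).
  by rewrite in_itv /= ge_min le_max !lexx !orbT.
- by rewrite in_itv /= ge_min le_max !lexx.
Qed.

(** Only the lag [c = a - b] matters: the order for this lag is carried back to [z] by recurrence,
    extended to all lags, then pushed forward along the orbit. *)
Lemma strongly_ordered_self z u v : ~ nbhs 0 C -> recurrent Phi z ->
  omega_limit Phi z u -> omega_limit Phi z v -> u <> v -> C (u - v) ->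
  forall u' v', omega_limit Phi z u' -> omega_limit Phi z v' -> u' <> v' ->
  nbhs (u' - v') C.
Proof.
move=> nC0 zz zu zv uv Cuv; have T0 := ltW T_gt0.
have [a [b [a0 b0 Cab]]] := ordered_orbit_points zu zv uv Cuv.
have nab : Phi a z <> Phi b z by move=> ab; apply: nC0; rewrite ab subrr in Cab.
have {Cab} := nbhs_singleton Cab.
wlog ba : a b a0 b0 nab / b <= a.
  move=> wlog_ba Cab; have [ba|/ltW ab] := leP b a; first exact: (wlog_ba a b).
  by apply: (wlog_ba b a) => //; [exact: nesym|exact: cone_sym].
move=> Cab; have [c c0 cba] : exists2 c, 0 <= c & c + b = a.
  by exists (a - b); rewrite ?subr_ge0// subrK.
have cb : Phi c (Phi b z) = Phi a z by rewrite (semiflowD flow)// cba.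
have Cc : C (Phi c z - z).
  (* A late point [Phi s z] arises from [Phi b z] after the time [s - b >= T], which preserves the
     order of [Phi a z] and [Phi b z]. *)
  suff : omega_limit Phi z `<=` [set u | C (Phi c u - u)] by apply.
  apply: (@omega_limit_sub_closed _ _ _ _ (T + b)).
    apply: (@preimage_closed _ _ (fun u => Phi c u - u)) => // w _.
    by apply: cvgB; [exact: (semiflow_continuousr flow)|exact: cvg_id].
  move=> s s0; rewrite -lerBrDr => Ts /=.
  have sb0 : 0 <= s - b := le_trans T0 Ts.
  rewrite -[s](subrK b) -(semiflowD flow)// (semiflowC flow)// cb.
  exact: weak_mono.
have cz : Phi c z <> z.
  move=> cz; apply: nab; rewrite -cb (semiflowC flow)//.
  by rewrite cz.
have Cz := self_ordered zz c0 cz Cc.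
apply: (@strongly_ordered_limits z z T) => //.
move=> s t s0 t0 Ts Tt.
wlog ts : s t s0 t0 Ts Tt / t <= s.
  move=> wlog_ts; have [ts|/ltW st] := leP t s; first exact: wlog_ts.
  by apply: cone_sym; exact: wlog_ts.
rewrite -[s](subrK t) -(semiflowD flow) ?subr_ge0// (semiflowC flow) ?subr_ge0//.
by apply: weak_mono => //; apply: Cz; rewrite subr_ge0.
Qed.

End StronglyMonotoneCone.

(** * The dichotomy for a single cone *)

Lemma cone_nbhs0 {R : realType} {X : normedModType R} (C : set X) :
  (forall (l : R) v, C v -> C (l *: v)) -> nbhs 0 C -> C = setT.
Proof.
move=> CZ /nbhs_ballP[e /= e0 eC]; apply/seteqP; split=> // u _.
have u1 : 0 < `|u| + 1 by rewrite ltr_wpDl.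
have l0 : 0 < e / (`|u| + 1) by rewrite divr_gt0.
rewrite -(scalerK (lt0r_neq0 l0) u); apply/CZ/eC.
rewrite -ball_normE /ball_ /= sub0r normrN normrZ gtr0_norm//.
by rewrite mulrAC ltr_pdivrMr// ltr_pM2l// ltrDl.
Qed.

Lemma order_dichotomy (R : realType) (X : completeNormedModType R)
    (Phi : R -> X -> X) (Gamma : set X) (C : set X) (k : nat) (x y : X) :
  continuous_semiflow Phi -> global_attractor Phi Gamma ->
  solid C -> is_kcone k C -> UESM Phi C ->
  recurrent Phi x -> recurrent Phi y ->
  (forall u v, omega_limit Phi x u -> omega_limit Phi y v -> u <> v ->
    interior C (u - v)) \/
  (forall u v, omega_limit Phi x u -> omega_limit Phi y v -> u <> v ->
    ~ C (u - v)).
Proof.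
move=> flow attractor [w Cw] Ck [T T0 mono] xx yy.
have C_closed := kcone_closed Ck.
have CZ := kcone_scale Ck.
have C0 : C 0 by rewrite -(scale0r w); apply: CZ; exact: interior_subset Cw.
have CN u : C u -> C (- u) by rewrite -scaleN1r; exact: CZ.
(* If 0 is interior, then [C] is the whole space and the order is trivially strong; otherwise
   interior differences are nonzero. *)
have [C0'|nC0] := pselect (nbhs 0 C).
  by left=> u v _ _ _; rewrite (cone_nbhs0 CZ C0') interiorT.
have [[u [v [xu yv uv Cuv]]]|no_pair] := pselect (exists u v,
    [/\ omega_limit Phi x u, omega_limit Phi y v, u <> v & C (u - v)]); last first.
  by right=> u v xu yv uv Cuv; apply: no_pair; exists u, v.
left.
have [yx|nyx] := pselect (omega_limit Phi y x); last first.
  exact: (strongly_ordered_separated flow attractor C_closed C0 T0 mono xx yy nyx xu yv).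
have xy : omega_limit Phi x `<=` omega_limit Phi y.
  apply: (@omega_limit_sub_closed _ _ _ x 0); first exact: omega_limit_closed.
  by move=> r r0 _; exact: omega_limit_invariant.
(* Both points of each pair now lie in the omega-limit set of [y]. *)
move=> u' v' /xy; move: u' v'.
exact: (strongly_ordered_self flow attractor C_closed C0 CN T0 mono nC0 yy (xy u xu) yv uv Cuv).
Qed.

(** * Choice of the index along the nested cones *)

Lemma elt_leq_trans (i j : nat) (N : enat) : (i < j)%N -> ele j N -> elt i N.
Proof. by case: N => // n ij jn; rewrite /elt /= -ltnNge (leq_trans ij). Qed.

Lemma eltW (i : nat) (N : enat) : elt i N -> ele i N.
Proof. by case: N => // n; rewrite /elt /= -ltnNge => /ltnW. Qed.

Lemma nics_mono (R : realType) (X : completeNormedModType R)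
    (Phi : R -> X -> X) (N : enat) (C : enat -> set X) (j i : nat) :
  NICs Phi N C -> (j <= i)%N -> ele i N -> C j `<=` C i.
Proof.
move=> nics; elim: i => [|i IH]; first by rewrite leqn0 => /eqP -> _ u.
rewrite leq_eqVlt => /predU1P[-> _ u//|ji iN].
apply: subset_trans (nics_nested nics iN); apply: IH => //.
exact/eltW/(elt_leq_trans (ltnSn i)).
Qed.

Theorem theorem4p1 (R : realType) (X : completeNormedModType R)
    (Phi : R -> X -> X) (Gamma : set X) (N : enat) (C : enat -> set X) (x y : X) :
  continuous_semiflow Phi ->
  eventually_compact Phi ->
  global_attractor Phi Gamma ->
  NICs Phi N C ->
  UESM_NICs Phi N C ->
  recurrent Phi x ->
  recurrent Phi y ->
  exists j : enat,
    [/\ elt 0%N j, ele j N,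
        strongly_ordered [set i | ele j i && ele i N] C
          (omega_limit Phi x) (omega_limit Phi y) &
        unordered [set i | elt i j] C
          (omega_limit Phi x) (omega_limit Phi y)].
Proof.
move=> flow _ attractor nics uesm xx yy.
pose ordered i := forall u v, omega_limit Phi x u -> omega_limit Phi y v ->
  u <> v -> interior (C i) (u - v).
have orderedN : ordered N by move=> u v _ _ _; rewrite (nics_last nics) interiorT.
have unordered_below (i : nat) : elt i N -> ((0 < i)%N -> ~ ordered i) ->
    forall u v, omega_limit Phi x u -> omega_limit Phi y v -> u <> v -> ~ C i (u - v).
  have [->|i_gt0] := posnP i.
    by move=> _ _ u v _ _ uv; rewrite (nics_first nics) => /subr0_eq.
  move=> iN /(_ isT) nord; have [k [/(_ i i_gt0 iN)[Ci_solid Ci_cone] _]] := nics_cones nics.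
  by case: (order_dichotomy flow attractor Ci_solid Ci_cone (uesm i i_gt0 iN) xx yy).
(* The index [j] is the least positive finite one with strong order: nesting gives the order above
   it, minimality and the dichotomy give its absence below. *)
have [[i [i_gt0 iN ordi]]|never] := pselect (exists i : nat,
    [/\ (0 < i)%N, ele i N & ordered i]).
  have ex : exists i : nat, `[< [/\ (0 < i)%N, ele i N & ordered i] >].
    by exists i; apply/asboolP.
  case: (ex_minnP ex) => j /asboolP[j_gt0 jN ordj] jmin.
  exists (Fin j); split=> //=.
  - by rewrite /elt /= -ltnNge.
  - move=> [l|] /andP[jl lN] u v xu yv uv.
      exact: interiorS (nics_mono nics jl lN) _ (ordj u v xu yv uv).
    have NI : N = Infty by case: (N) lN.
    by rewrite -NI; exact: orderedN.
  - move=> [l|] //; rewrite /= /elt /= -ltnNge => lj.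
    have lN := elt_leq_trans lj jN.
    apply: unordered_below => // l_gt0 ordl.
    have /asboolP/jmin : [/\ (0 < l)%N, ele l N & ordered l] by split=> //; exact: eltW.
    by rewrite leqNgt lj.
(* A finite [N] would itself be a positive index with strong order. *)
have NI : N = Infty.
  case: N nics orderedN never {uesm unordered_below} => // n nics ordn [].
  exists n; split=> //; last by rewrite /=.
  by have := nics_N_gt0 nics; rewrite /elt /= -ltnNge.
exists Infty; split=> //; first by rewrite NI.
- move=> [i|] // _ u v xu yv uv; rewrite -NI; exact: orderedN.
- move=> [i|] // _; apply: unordered_below; first by rewrite NI.
  by move=> i_gt0 ordi; apply: never; exists i; rewrite NI.
Qed.
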